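(* A discrete Hecke pair $(G,H)$ is relatively unimodular if and only if it is locally commutative.
   Context: A discrete Hecke pair $(G,H)$ consists of a locally compact group $G$ and an open subgroup $H$ such that every double coset $HxH$ ($x\in G$) is a union of finitely many left cosets of $H$ in $G$. (The notions below depend only on the abstract groups.) For $x\in G$ let $L(x)=|HxH/H|$ be the number of left cosets of $H$ in $HxH$, let $R(x)=|H\backslash HxH|$ be the number of right cosets of $H$ in $HxH$ (so $R(x)=L(x^{-1})$), and let $\Delta_{(G,H)}(x)=L(x)/R(x)$; this is the relative modular function. The pair is relatively unimodular if $\Delta_{(G,H)}(x)=1$ for all $x\in G$. $\mathcal{H}(G,H)$ is the algebra of finitely supported complex functions on the set $G//H$ of double cosets, with product $(f_1\ast f_2)(HxH)=\sum_{Hy\in H\backslash G}f_1(Hxy^{-1}H)f_2(HyH)$. For $g\in G$, $\chi_g\in\mathcal{H}(G,H)$ is the characteristic function of the double coset $HgH$. The pair is locally commutative if $(\chi_g\ast\chi_{g^{-1}})(H)=(\chi_{g^{-1}}\ast\chi_g)(H)$ for all $g\in G$. *)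

(* Defs.v *)
From HB Require Import structures.
From mathcomp Require Import all_boot all_order all_algebra finmap.
From mathcomp Require Import all_classical all_reals topology.
From mathcomp Require Import complex.

Set Implicit Arguments.
Unset Strict Implicit.
Unset Printing Implicit Defensive.

Import Order.TTheory GRing.Theory Num.Theory.

Local Open Scope classical_set_scope.
Local Open Scope group_scope.

HB.mixin Record isTopologicalGroup G & Topological G & Group G := {
  mulg_continuous : continuous (fun x : G * G => x.1 * x.2) ;
  invg_continuous : continuous (fun x : G => x^-1)
}.

#[short(type="topologicalGroupType")]
HB.structure Definition TopologicalGroup :=
  {G of Topological G & Group G & isTopologicalGroup G}.

Section Cosets.
Context {G : groupType} (H : groupClosed G).
Implicit Types (x y z h k : G) (A : set G).

Definition left_coset x : set G := [set x * h | h in [set` H]].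
Definition right_coset x : set G := [set h * x | h in [set` H]].
Definition double_coset x : set G :=
  [set h * x * k | h in [set` H] & k in [set` H]].

(* A / H and H \ A, for A a union of left, resp. right, cosets *)
Definition left_cosets_of A : set (set G) := [set left_coset y | y in A].
Definition right_cosets_of A : set (set G) := [set right_coset y | y in A].

(* G // H *)
Definition double_coset_space := set_type (range double_coset).

Definition dcoset x : double_coset_space :=
  SigSub (mem_set (imageT double_coset x)).

Definition coset_repr A : G := xget 1 A.

Lemma coset_reprP A : A !=set0 -> A (coset_repr A).
Proof. by move=> [x Ax]; apply: (xgetPex 1); exists x. Qed.

Lemma right_coset_refl x : right_coset x x.
Proof. by exists 1; [exact: gpred1 | rewrite mul1g]. Qed.

Lemma double_coset_refl x : double_coset x x.
Proof.
by exists 1; [exact: gpred1 | exists 1; [exact: gpred1 | rewrite mul1g mulg1]].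
Qed.

Lemma right_coset_mul h x : h \in H -> right_coset (h * x) = right_coset x.
Proof.
move=> Hh; apply/seteqP; split=> _ [k /= Hk <-].
  by exists (k * h); rewrite /= ?gpredM// mulgA.
by exists (k * h^-1); rewrite /= ?gpredM ?gpredV// -!mulgA mulKg.
Qed.

Lemma double_coset_mul h k x : h \in H -> k \in H ->
  double_coset (h * x * k) = double_coset x.
Proof.
move=> Hh Hk; apply/seteqP; split=> _ [u /= Hu [v /= Hv <-]].
  exists (u * h); first by rewrite /= gpredM.
  by exists (k * v); [rewrite /= gpredM | rewrite !mulgA].
exists (u * h^-1); first by rewrite /= gpredM ?gpredV.
exists (k^-1 * v); first by rewrite /= gpredM ?gpredV.
by rewrite -!mulgA mulKg mulVKg.
Qed.

Lemma dcoset_mul h k x : h \in H -> k \in H -> dcoset (h * x * k) = dcoset x.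
Proof. by move=> Hh Hk; apply/val_inj; exact: double_coset_mul. Qed.

Lemma dcoset_mull h x : h \in H -> dcoset (h * x) = dcoset x.
Proof. by move=> Hh; rewrite -[h * x]mulg1 dcoset_mul ?gpred1. Qed.

Lemma dcoset_mulr k x : k \in H -> dcoset (x * k) = dcoset x.
Proof. by move=> Hk; rewrite -[x]mul1g dcoset_mul ?gpred1// mul1g. Qed.

Lemma dcoset_eq x y : double_coset x y -> dcoset y = dcoset x.
Proof. by move=> [h Hh [k Hk <-]]; exact: dcoset_mul. Qed.

Lemma dcoset_surj (D : double_coset_space) : exists x, D = dcoset x.
Proof.
case: D => D DP; have [x _ xD] := set_mem DP.
by exists x; apply/val_inj; rewrite /= xD.
Qed.

Lemma dcoset_repr (D : double_coset_space) : dcoset (coset_repr (val D)) = D.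
Proof.
have [x ->] := dcoset_surj D; apply: dcoset_eq; apply: coset_reprP.
by exists x; exact: double_coset_refl.
Qed.

End Cosets.

Record discreteHeckePair (G : topologicalGroupType) := DiscreteHeckePair {
  hecke_subgroup :> groupClosed G ;
  hecke_locally_compact : locally_compact [set: G] ;
  hecke_open : open [set` hecke_subgroup] ;
  hecke_finite : forall x : G, exists s : seq G,
    double_coset hecke_subgroup x =
      \bigcup_(y in [set` s]) left_coset hecke_subgroup y
}.

Section RelativeModularFunction.
Context {G : topologicalGroupType} (H : discreteHeckePair G).

Definition hecke_L (x : G) : nat :=
  #|` fset_set (left_cosets_of H (double_coset H x)) |.

Definition hecke_R (x : G) : nat :=
  #|` fset_set (right_cosets_of H (double_coset H x)) |.

Definition relative_modular (x : G) : rat :=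
  ((hecke_L x)%:R / (hecke_R x)%:R)%R.

Definition relatively_unimodular : Prop :=
  forall x : G, relative_modular x = 1%R.

End RelativeModularFunction.

Section Finiteness.
Context {G : topologicalGroupType} (H : discreteHeckePair G).

Lemma finite_left_cosets (x : G) :
  finite_set (left_cosets_of H (double_coset H x)).
Proof.
have [s ->] := hecke_finite H x.
apply: (@sub_finite_set _ _ (left_coset H @` [set` s])); last first.
  exact/finite_image/finite_seq.
move=> _ [_ [y sy [h /= Hh <-]] <-]; exists y => //.
apply/seteqP; split=> _ [k /= Hk <-].
  by exists (h^-1 * k); rewrite /= ?gpredM ?gpredV// -mulgA mulVKg.
by exists (h * k); rewrite /= ?gpredM// mulgA.
Qed.

Lemma finite_right_cosets (x : G) :
  finite_set (right_cosets_of H (double_coset H x)).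
Proof.
pose inv_set (A : set G) := [set y^-1 | y in A].
apply: (@sub_finite_set _ _
  (inv_set @` left_cosets_of H (double_coset H x^-1))); last first.
  exact/finite_image/finite_left_cosets.
move=> _ [_ [h /= Hh [k /= Hk <-]] <-].
exists (left_coset H (k^-1 * x^-1 * h^-1)).
  exists (k^-1 * x^-1 * h^-1) => //.
  by exists k^-1; [rewrite /= gpredV | exists h^-1; rewrite //= gpredV].
apply/seteqP; split=> [_ [_ [u /= Hu <-] <-]|_ [u /= Hu <-]].
  by exists u^-1; rewrite /= ?gpredV// !invgM !invgK !mulgA.
exists (k^-1 * x^-1 * h^-1 * u^-1); last by rewrite !invgM !invgK !mulgA.
by exists u^-1; rewrite //= gpredV.
Qed.

End Finiteness.

Section HeckeAlgebra.
Variable R : realType.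
Context {G : topologicalGroupType} (H : discreteHeckePair G).

Record heckeAlgebra := HeckeAlgebra {
  hecke_fun :> double_coset_space H -> R[i] ;
  hecke_funP : finite_set [set D | hecke_fun D != 0%R]
}.

Implicit Types (f : heckeAlgebra) (x y g : G).

Lemma hecke_char_finite g :
  finite_set [set D | ((D == dcoset H g)%:R != 0 :> R[i])%R].
Proof.
apply: (@sub_finite_set _ _ [set dcoset H g]); last exact: finite_set1.
by move=> D /=; case: (D =P _) => // _; rewrite eqxx.
Qed.

Definition hecke_char g : heckeAlgebra :=
  @HeckeAlgebra (fun D => (D == dcoset H g)%:R%R) (hecke_char_finite g).

(* The defining formula at H x H, for a chosen representative x of H x H and a
   chosen representative y of each right coset H y; by [hecke_mulE] below, the
   choices are irrelevant. *)
Definition hecke_mul_fun f1 f2 (D : double_coset_space H) : R[i] :=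
  let x := coset_repr (val D) in
  (\sum_(C \in range (right_coset H))
     let y := coset_repr C in f1 (dcoset H (x * y^-1)%g) * f2 (dcoset H y))%R.

Let term f1 f2 x y : R[i] := (f1 (dcoset H (x * y^-1)%g) * f2 (dcoset H y))%R.

Let term_right f1 f2 x h y : h \in H -> term f1 f2 x (h * y) = term f1 f2 x y.
Proof.
by move=> Hh; rewrite /term dcoset_mull// invgM mulgA dcoset_mulr// gpredV.
Qed.

Let term_coset f1 f2 x y z : right_coset H y z ->
  term f1 f2 x z = term f1 f2 x y.
Proof. by move=> [h Hh <-]; exact: term_right. Qed.

(* [\sum_(_ \in _)] is 0 by convention on infinite supports; this never occurs
   in [hecke_mul_fun]. *)
Lemma hecke_mul_term_finite f1 f2 x : finite_set
  (range (right_coset H) `&` [set C | let y := coset_repr C in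
     (f1 (dcoset H (x * y^-1)%g) * f2 (dcoset H y) != 0)%R]).
Proof.
apply: (@sub_finite_set _ _ (\bigcup_(D in [set D | f2 D != 0%R])
    right_cosets_of H (double_coset H (coset_repr (val D))))); last first.
  by apply: bigcup_finite => [|D _];
    [exact: hecke_funP | exact: finite_right_cosets].
move=> _ [[y _ <-] /=]; set z := coset_repr _ => nz.
exists (dcoset H z) => /=.
  by apply: contra_neq nz => ->; rewrite mulr0.
have [h Hh zE] : right_coset H y z.
  by apply: coset_reprP; exists y; exact: right_coset_refl.
exists z; last by rewrite -zE; exact: right_coset_mul.
have := congr1 val (dcoset_repr (dcoset H z)) => /= ->.
exact: double_coset_refl.
Qed.

Lemma hecke_mulE f1 f2 (r : set G -> G) x :
  (forall y, right_coset H y (r (right_coset H y))) ->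
  hecke_mul_fun f1 f2 (dcoset H x) =
  (\sum_(C \in range (right_coset H))
     f1 (dcoset H (x * (r C)^-1)%g) * f2 (dcoset H (r C)))%R.
Proof.
move=> rP; rewrite /hecke_mul_fun /=.
have cP y : right_coset H y (coset_repr (right_coset H y)).
  by apply: coset_reprP; exists y; exact: right_coset_refl.
have [h Hh [k Hk xE]] : double_coset H x (coset_repr (double_coset H x)).
  by apply: coset_reprP; exists x; exact: double_coset_refl.
rewrite -xE; pose shift (C : set G) := [set z * k | z in C].
have shiftE y : shift (right_coset H y) = right_coset H (y * k).
  apply/seteqP; split=> [_ [_ [u Hu <-] <-]|_ [u Hu <-]].
    by exists u; rewrite // mulgA.
  by exists (u * y); rewrite ?mulgA//; exists u.
rewrite (@reindex_fsbig _ _ _ _ _ shift (range (right_coset H))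
  (range (right_coset H))); last first.
  split.
  - by move=> _ [y _ <-]; rewrite shiftE; exists (y * k).
  - move=> C C' _ _ CC'.
    have shiftK : cancel shift (fun C : set G => [set z * k^-1 | z in C]).
      move=> A; apply/seteqP; split=> [_ [_ [z Az <-] <-]|z Az].
        by rewrite mulgK.
      by exists (z * k); rewrite ?mulgK//; exists z.
    exact: (can_inj shiftK).
  - move=> _ [y _ <-]; exists (right_coset H (y * k^-1)) => //.
    by rewrite shiftE mulgVK.
apply: eq_fsbigr => C /set_mem[y _ <-]; rewrite shiftE.
rewrite -/(term f1 f2 _ _) -/(term f1 f2 _ _).
rewrite (term_coset _ _ _ (cP _)) (term_coset _ _ _ (rP _)) /term.
rewrite [dcoset H (y * k)]dcoset_mulr//; congr (f1 _ * _)%R.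
by rewrite invgM mulgA mulgK -mulgA dcoset_mull.
Qed.

Lemma hecke_mul_finite f1 f2 :
  finite_set [set D | hecke_mul_fun f1 f2 D != 0%R].
Proof.
pose s (B : double_coset_space H) :=
  sval (cid (hecke_finite H (coset_repr (val B)))).
apply: (@sub_finite_set _ _ (\bigcup_(A in [set D | f1 D != 0%R])
  \bigcup_(B in [set D | f2 D != 0%R])
  [set dcoset H (coset_repr (val A) * y) | y in [set` s B]])); last first.
  apply: bigcup_finite => [|A _]; first exact: hecke_funP.
  apply: bigcup_finite => [|B _]; first exact: hecke_funP.
  exact/finite_image/finite_seq.
move=> D /= nz; rewrite -(dcoset_repr D); move: nz.
rewrite /hecke_mul_fun; set x := coset_repr (val D) => nz.
have [C [_ tC]] : exists C, range (right_coset H) C /\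
    term f1 f2 x (coset_repr C) != 0%R.
  apply/not_existsP => /= noC; case/eqP: nz; apply: fsbig1 => C rC /=.
  by apply/eqP/negPn/negP => nzC; apply: (noC C).
move: tC; set y := coset_repr C; rewrite /term mulf_eq0 negb_or => /andP[n1 n2].
exists (dcoset H (x * y^-1)) => //; exists (dcoset H y) => //.
set a := coset_repr _.
have [h Hh [k Hk aE]] : double_coset H (x * y^-1) a.
  apply: coset_reprP; exists (x * y^-1); exact: double_coset_refl.
have sE := svalP (cid (hecke_finite H (coset_repr (val (dcoset H y))))).
rewrite /= -/(s (dcoset H y)) in sE.
have : double_coset H (coset_repr (double_coset H y)) (k^-1 * y).
  have := congr1 val (dcoset_repr (dcoset H y)) => /= ->.
  exists k^-1; first by rewrite /= gpredV.
  by exists 1; [exact: gpred1 | rewrite mulg1].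
rewrite sE => -[z sz [l Hl zl]]; exists z => //.
have -> : z = k^-1 * y * l^-1 by rewrite -zl mulgK.
rewrite -aE !mulgA mulgK dcoset_mulr ?gpredV//.
by rewrite -!mulgA mulVg mulg1 dcoset_mull.
Qed.

Definition hecke_mul f1 f2 : heckeAlgebra :=
  @HeckeAlgebra (hecke_mul_fun f1 f2) (hecke_mul_finite f1 f2).

Definition locally_commutative : Prop := forall g : G,
  hecke_mul (hecke_char g) (hecke_char g^-1) (dcoset H 1) =
  hecke_mul (hecke_char g^-1) (hecke_char g) (dcoset H 1).

End HeckeAlgebra.

(* Main.v *)
Require Import Defs.
From mathcomp Require Import all_boot all_order all_algebra.
From mathcomp Require Import all_classical all_reals topology complex.
From mathcomp Require Import finmap.

(** At the trivial double coset, the convolution of two characteristic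
    functions merely counts.  In the sum for [chi_(a^-1) * chi_a] at [H], the
    term of a right coset [H y] is [chi_(a^-1)(H y^-1 H) chi_a(H y H)].  Both
    factors express the same condition, namely that [y] lies in [H a H], since
    inversion exchanges [H a H] and [H a^-1 H].  The value is therefore the
    number of right cosets in [H a H], that is [R(a)]
    ([hecke_mul_char_inv]).

    Taking [a := g] and [a := g^-1], local commutativity says that
    [R(g^-1) = R(g)] for all [g].  Inversion also maps the left cosets in
    [H g H] bijectively to the right cosets in [H g^-1 H], so
    [R(g^-1) = L(g)] ([hecke_R_inv]), and the condition becomes
    [L(g) = R(g)].  As [R(g)] is nonzero, this is [L(g) / R(g) = 1]. *)

Set Implicit Arguments.
Unset Strict Implicit.
Unset Printing Implicit Defensive.

Import GRing.Theory Num.Theory.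

Local Open Scope classical_set_scope.
Local Open Scope group_scope.

Section Inversion.
Context {G : groupType} (H : groupClosed G).
Implicit Types (x y : G) (A : set G).

Lemma inv_left_coset x :
  [set z^-1 | z in left_coset H x] = right_coset H x^-1.
Proof.
apply/seteqP; split=> [_ [_ [h /= Hh <-] <-]|_ [h /= Hh <-]].
  by exists h^-1; rewrite /= ?gpredV// invgM.
exists (x * h^-1); last by rewrite invgM invgK.
by exists h^-1; rewrite //= gpredV.
Qed.

Lemma double_cosetV x y : double_coset H x y -> double_coset H x^-1 y^-1.
Proof.
move=> [h /= Hh [k /= Hk <-]]; exists k^-1; first by rewrite /= gpredV.
by exists h^-1; rewrite /= ?gpredV// !invgM mulgA.
Qed.

Lemma inv_double_coset x :
  [set z^-1 | z in double_coset H x] = double_coset H x^-1.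
Proof.
apply/seteqP; split=> [_ [y xy <-]|y /double_cosetV].
  exact: double_cosetV.
by rewrite invgK => xy; exists y^-1; rewrite ?invgK.
Qed.

Lemma dcoset_eqP x y : dcoset H y = dcoset H x <-> double_coset H x y.
Proof.
split=> [/(congr1 val) /= <-|]; [exact: double_coset_refl|exact: dcoset_eq].
Qed.

Lemma dcosetV_eq x y :
  (dcoset H y^-1 == dcoset H x^-1) = (dcoset H y == dcoset H x).
Proof.
apply/eqP/eqP => /dcoset_eqP/double_cosetV xy; apply/dcoset_eqP => //.
by move: xy; rewrite !invgK.
Qed.

(** A double coset is a union of right cosets, so membership of the right coset
    of [y] can be read off from the representative [y] alone. *)
Lemma right_cosets_of_double_cosetE x y :
  right_cosets_of H (double_coset H x) (right_coset H y) <->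
  dcoset H y = dcoset H x.
Proof.
split=> [[z xz zy]|/dcoset_eqP xy]; last by exists y.
have [h Hh <-] : right_coset H z y by rewrite zy; exact: right_coset_refl.
by rewrite dcoset_mull//; apply/dcoset_eqP.
Qed.

Lemma right_cosets_of_double_cosetV x :
  right_cosets_of H (double_coset H x^-1) =
  (fun A => [set z^-1 | z in A]) @` left_cosets_of H (double_coset H x).
Proof.
rewrite -inv_double_coset /right_cosets_of /left_cosets_of !image_comp.
by apply: eq_imagel => y _ /=; rewrite inv_left_coset.
Qed.

End Inversion.

Section Counting.
Context {G : topologicalGroupType} (H : discreteHeckePair G).
Implicit Types x y : G.

(** Inversion carries [x H] to [H x^-1], and being an involution it loses no
    coset. *)
Lemma hecke_R_inv x : hecke_R H x^-1 = hecke_L H x.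
Proof.
rewrite /hecke_R /hecke_L right_cosets_of_double_cosetV.
rewrite fset_set_image; last exact: finite_left_cosets.
rewrite card_imfset//=.
apply: (@can_inj _ _ _ (image^~ (fun z : G => z^-1))) => A.
by rewrite image_comp; under eq_imagel do rewrite /= invgK; rewrite image_id.
Qed.

Lemma hecke_R_neq0 x : hecke_R H x != 0%N.
Proof.
rewrite /hecke_R cardfs_eq0; apply/eqP => /fset_set_set0.
move=> /(_ (finite_right_cosets H x)) e.
have : right_cosets_of H (double_coset H x) (right_coset H x).
  exact/right_cosets_of_double_cosetE.
by rewrite e.
Qed.

(** The two characteristic functions in each term test the same condition on
    the right coset, so their product is the indicator of the right cosets
    that make up the double coset of [x]. *)
Lemma hecke_mul_char_inv (R : realType) x :
  hecke_mul (hecke_char R H x^-1) (hecke_char R H x) (dcoset H 1) =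
  ((hecke_R H x)%:R)%R.
Proof.
set Q := right_cosets_of H (double_coset H x).
have reprP y : right_coset H y (coset_repr (right_coset H y)).
  by apply: coset_reprP; exists y; exact: right_coset_refl.
rewrite /= (hecke_mulE _ _ _ reprP).
transitivity
  (\sum_(C \in range (right_coset H)) if C \in Q then 1 else 0 : R[i])%R.
  apply: eq_fsbigr => C /set_mem[y _ <-].
  have [h Hh <-] := reprP y.
  rewrite mul1g /= dcosetV_eq dcoset_mull//.
  have -> : (right_coset H y \in Q) = (dcoset H y == dcoset H x).
    apply/idP/eqP; first by move/set_mem/right_cosets_of_double_cosetE.
    by move=> yx; apply/mem_set/right_cosets_of_double_cosetE.
  by case: eqP => _; rewrite ?mulr1 ?mulr0.
rewrite -fsbig_mkcondr setIidr; last by move=> _ [y _ <-]; exists y.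
rewrite fsbig_finite/=; last exact: finite_right_cosets.
by rewrite big_const_seq count_predT iter_addr_0.
Qed.

End Counting.

Theorem proposition3p2 (R : realType) (G : topologicalGroupType)
    (H : discreteHeckePair G) :
  relatively_unimodular H <-> locally_commutative R H.
Proof.
have mulE g : hecke_mul (hecke_char R H g) (hecke_char R H g^-1) (dcoset H 1) =
    ((hecke_L H g)%:R)%R.
  by rewrite -{1}[g]invgK hecke_mul_char_inv hecke_R_inv.
have R0 g : ((hecke_R H g)%:R != 0 :> rat)%R by rewrite pnatr_eq0 hecke_R_neq0.
split=> [uni|comm].
  suff LR g : hecke_L H g = hecke_R H g.
    by move=> g; rewrite mulE hecke_mul_char_inv LR.
  have /divr1_eq/eqP := uni g.
  by rewrite eqr_nat => /eqP.
move=> g; have /eqP := comm g.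
rewrite mulE hecke_mul_char_inv eqr_nat => /eqP LR.
by rewrite /relative_modular LR divff.
Qed.
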